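(* Let $\{X_n\}_{n\ge 1}$ be a sequence of pairwise independent, identically distributed real-valued random variables on a probability space $(\Omega,\mathbf{F},\mathbb{P})$ with $\mathbb{E}(X_1)=0$ and $\mathrm{Var}(X_1)<\infty$. Then, for all $\varepsilon>0$ and all real $r<0$, $$\sum_{n=1}^\infty n^r P^*_{n,\varepsilon}<\infty.$$
   Context: For a sequence of random variables $\{X_n\}_{n\ge1}$, put $S_n:=\sum_{i=1}^n X_i$ and, for $\varepsilon>0$ and $n\ge 1$, $P^*_{n,\varepsilon}:=\mathbb{P}\left(\sup_{m\ge n}\left|\frac{S_m}{m}\right|>\varepsilon\right)$. *)

(* Defs.v *)
From HB Require Import structures.
From mathcomp Require Import all_boot all_order all_algebra.
From mathcomp Require Import all_classical all_reals all_analysis.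
Set Implicit Arguments.
Unset Strict Implicit.
Unset Printing Implicit Defensive.
Import Order.TTheory GRing.Theory Num.Theory.
Local Open Scope classical_set_scope.
Local Open Scope ring_scope.

(* Sequences are indexed from 0: [X i] stands for the variable X_{i+1}. *)

Definition pairwise_independent (d : measure_display) (T : measurableType d)
    (R : realType) (P : probability T R) (X : nat -> {RV P >-> R}) : Prop :=
  forall i j : nat, i != j -> forall A B : set R,
    measurable A -> measurable B ->
    P ((X i @^-1` A) `&` (X j @^-1` B)) =
      (P (X i @^-1` A) * P (X j @^-1` B))%E.

Definition identically_distributed (d : measure_display)
    (T : measurableType d) (R : realType) (P : probability T R)
    (X : nat -> {RV P >-> R}) : Prop :=
  forall (i j : nat) (A : set R), measurable A ->
    distribution P (X i) A = distribution P (X j) A.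

Definition partial_sum (d : measure_display) (T : measurableType d)
    (R : realType) (P : probability T R) (X : nat -> {RV P >-> R})
    (n : nat) (w : T) : R :=
  \sum_(0 <= i < n) X i w.

(* The supremum is taken in [\bar R] because it may be infinite. *)
Definition Pstar (d : measure_display) (T : measurableType d)
    (R : realType) (P : probability T R) (X : nat -> {RV P >-> R})
    (n : nat) (eps : R) : \bar R :=
  P [set w : T | (eps%:E < ereal_sup
       [set (`|partial_sum X m w / m%:R|)%:E | m in [set m : nat | (n <= m)%N]])%E].

(* Main.v *)
Require Import Defs.
From HB Require Import structures.
From mathcomp Require Import all_boot all_order all_algebra.
From mathcomp Require Import all_classical all_reals all_analysis.
From mathcomp Require Import measurable_realfun.
From mathcomp Require Import ring lra zify.
Set Implicit Arguments.
Unset Strict Implicit.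
Unset Printing Implicit Defensive.
Import Order.TTheory GRing.Theory Num.Theory.
Local Open Scope classical_set_scope.
Local Open Scope ring_scope.

(** The proof is a quantitative form of Etemadi's argument.

    Split X into its positive part A and its negative part B.  Each of these
    is again pairwise independent, identically distributed and square
    integrable, and since X has mean 0 both have the same mean mu.  Pairwise
    independence makes the terms uncorrelated, so the variance of a partial
    sum of A or B is linear in the number n of terms, and Chebyshev's
    inequality bounds the probability that the sum is at distance at least
    n * eta from n * mu by a constant times 1 / n
    ([ge0_chebyshev_partial_sum]).

    The partial sums of A and of B are nondecreasing, and this is what makes
    the supremum over m >= n tractable without any maximal inequality.  Fix a
    large L and let g_0 = n, g_(k+1) = g_k + floor (g_k / L).  If a monotone
    sum is close to its mean at g_k and at g_(k+1), it is close to its mean at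
    every index in between ([monotone_bracket]), because g_(k+1) / g_k is at
    most 1 + 1 / L.  Hence the event that defines P*_n is contained in the
    union over k of the deviation events at the indices g_k
    ([exceed_subset_deviation]).  As g_k also grows at least geometrically
    when n >= L, the Chebyshev bounds along the grid are dominated by a
    geometric series with sum at most C / n ([Pstar_le_inv]).

    It remains to sum n^r * C / n with r < 0; by comparison with the
    telescoping series of n^r - (n+1)^r, the sum is at most C * (1 - 1 / r)
    ([sum_powR_div_le]). *)

(** * Expectation of a product of independent variables *)

(** Independence says that the joint law agrees with the product of the laws
    on rectangles, hence everywhere; Tonelli's theorem then applies. *)
Lemma ge0_integral_indep (d d1 d2 : measure_display) (T : measurableType d)
    (T1 : measurableType d1) (T2 : measurableType d2) (R : realType)
    (P : probability T R) (X : {RV P >-> T1}) (Y : {RV P >-> T2})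
    (f : T1 * T2 -> \bar R) :
  (forall A B, measurable A -> measurable B ->
    P ((X @^-1` A) `&` (Y @^-1` B)) = (P (X @^-1` A) * P (Y @^-1` B))%E) ->
  measurable_fun setT f -> (forall z, 0 <= f z)%E ->
  (\int[P]_w f (X w, Y w) =
   \int[distribution P X]_x \int[distribution P Y]_y f (x, y))%E.
Proof.
move=> XY mf f0.
have mZ : measurable_fun setT (fun w => (X w, Y w)) by exact/measurable_fun_pair.
pose Z : {mfun T >-> (T1 * T2)%type} := mfun_Sub (mem_set mZ).
transitivity (\int[distribution P Z]_z f z)%E.
  by rewrite ge0_integral_distribution.
transitivity (\int[(distribution P X \x distribution P Y)%E]_z f z)%E.
  apply: eq_measure_integral => A mA _; apply/esym.
  by apply: product_measure_unique => // B C mB mC; rewrite -XY.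
by rewrite fubini_tonelli1.
Qed.

Lemma expectation_indepM (d : measure_display) (T : measurableType d)
    (R : realType) (P : probability T R) (X Y : {RV P >-> R}) :
  (forall w, 0 <= X w) -> (forall w, 0 <= Y w) ->
  (forall A B : set R, measurable A -> measurable B ->
    P ((X @^-1` A) `&` (Y @^-1` B)) = (P (X @^-1` A) * P (Y @^-1` B))%E) ->
  ('E_P[X \* Y] = 'E_P[X] * 'E_P[Y])%E.
Proof.
move=> X0 Y0 XY.
have mn : measurable_fun setT (fun x : R => `|x|%:E) by exact/measurable_EFinP.
have n0 (x : R) : (0 <= `|x|%:E)%E by rewrite lee_fin.
(* The integrand on the laws has to be nonnegative on all of R, not only on
   the ranges of X and Y; hence the absolute values. *)
have EN (U : {RV P >-> R}) : (forall w, 0 <= U w) ->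
    (\int[distribution P U]_y `|y|%:E = 'E_P[U])%E.
  move=> U0; rewrite ge0_integral_distribution// unlock.
  by apply: eq_integral => w _ /=; rewrite ger0_norm.
transitivity (\int[P]_w (`|X w|%:E * `|Y w|%:E))%E.
  by rewrite unlock; apply: eq_integral => w _ /=; rewrite !ger0_norm.
rewrite (@ge0_integral_indep _ _ _ _ _ _ _ _ X Y
  (fun z => `|z.1|%:E * `|z.2|%:E)%E)//=; last first.
  by apply: emeasurable_funM; apply/measurable_EFinP; apply: measurableT_comp.
under eq_integral => x _ do rewrite ge0_integralZl//.
by rewrite ge0_integralZr// ?integral_ge0// !EN.
Qed.

(** * Partial sums of uncorrelated variables *)

Lemma Lfun2_sqr (d : measure_display) (T : measurableType d) (R : realType)
    (P : probability T R) (X : {RV P >-> R}) :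
  (\int[P]_w ((X w) ^+ 2)%:E < +oo)%E -> (X : T -> R) \in Lfun P 2%:E.
Proof.
move=> X2; rewrite inE; apply/andP; split; rewrite inE//=.
rewrite /finite_norm unlock poweR_lty//=.
by under eq_integral => w _ do rewrite powR_mulrn// -normrX ger0_norm ?sqr_ge0//.
Qed.

Lemma ge0_integral_ident (d : measure_display) (T : measurableType d)
    (R : realType) (P : probability T R) (X : nat -> {RV P >-> R})
    (f : R -> \bar R) (i j : nat) :
  identically_distributed X -> measurable_fun setT f ->
  (forall x, 0 <= f x)%E ->
  (\int[P]_w f (X i w) = \int[P]_w f (X j w))%E.
Proof.
move=> ident mf f0.
transitivity (\int[distribution P (X i)]_x f x)%E.
  by rewrite ge0_integral_distribution.
transitivity (\int[distribution P (X j)]_x f x)%E.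
  by apply: eq_measure_integral => A mA _; exact: ident.
by rewrite ge0_integral_distribution.
Qed.

Lemma partial_sumS (d : measure_display) (T : measurableType d) (R : realType)
    (P : probability T R) (X : nat -> {RV P >-> R}) (n : nat) :
  partial_sum X n.+1 = partial_sum X n \+ X n.
Proof. by apply/funext => w; rewrite /partial_sum big_nat_recr. Qed.

Lemma partial_sum0 (d : measure_display) (T : measurableType d) (R : realType)
    (P : probability T R) (X : nat -> {RV P >-> R}) :
  partial_sum X 0 = cst 0.
Proof. by apply/funext => w; rewrite /partial_sum big_geq. Qed.

Lemma measurable_partial_sum (d : measure_display) (T : measurableType d)
    (R : realType) (P : probability T R) (X : nat -> {RV P >-> R}) (n : nat) :
  measurable_fun setT (partial_sum X n).
Proof.
elim: n => [|n IHn]; first by rewrite partial_sum0.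
by rewrite partial_sumS; exact: measurable_funD.
Qed.

Lemma Lfun2_partial_sum (d : measure_display) (T : measurableType d)
    (R : realType) (P : probability T R) (X : nat -> {RV P >-> R}) (n : nat) :
  (forall i, (X i : T -> R) \in Lfun P 2%:E) ->
  partial_sum X n \in Lfun P 2%:E.
Proof.
move=> X2; elim: n => [|n IHn]; first by rewrite partial_sum0 Lfun_cst.
by rewrite partial_sumS rpredD// lee1n.
Qed.

Lemma expectation_partial_sum (d : measure_display) (T : measurableType d)
    (R : realType) (P : probability T R) (X : nat -> {RV P >-> R}) (mu : R)
    (n : nat) :
  (forall i, (X i : T -> R) \in Lfun P 2%:E) ->
  (forall i, 'E_P[X i] = mu%:E)%E ->
  ('E_P[partial_sum X n] = (n%:R * mu)%:E)%E.
Proof.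
move=> X2 EX; have L21 := Lfun_subset12 (fin_num_measure P _ measurableT).
elim: n => [|n IHn]; first by rewrite partial_sum0 expectation_cst mul0r.
rewrite partial_sumS expectationD ?L21 ?Lfun2_partial_sum// IHn EX -EFinD.
by rewrite -natr1 mulrDl mul1r.
Qed.

Lemma variance_partial_sum (d : measure_display) (T : measurableType d)
    (R : realType) (P : probability T R) (X : nat -> {RV P >-> R}) (v : R)
    (n : nat) :
  (forall i, (X i : T -> R) \in Lfun P 2%:E) ->
  (forall i j, i != j -> covariance P (X i) (X j) = 0%E) ->
  (forall i, 'V_P[X i] = v%:E)%E ->
  ('V_P[partial_sum X n] = (n%:R * v)%:E)%E.
Proof.
move=> X2 cov0 VX.
have S2 m : partial_sum X m \in Lfun P 2%:E by exact: Lfun2_partial_sum.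
have cov_sum m k : (m <= k)%N -> covariance P (partial_sum X m) (X k) = 0%E.
  elim: m => [|m IHm] mk; first by rewrite partial_sum0 covariance_cst_l.
  rewrite partial_sumS (covarianceDl (S2 m) (X2 m) (X2 k)) (IHm (ltnW mk)).
  by rewrite add0e cov0// ltn_eqF.
elim: n => [|n IHn]; first by rewrite partial_sum0 variance_cst mul0r.
rewrite partial_sumS (varianceD (S2 n) (X2 n)) IHn VX (cov_sum _ _ (leqnn n)).
by rewrite mule0 adde0 -EFinD -natr1 mulrDl mul1r.
Qed.

(** With uncorrelated terms the variance is only n * v, while the deviation
    n * eta enters squared: this leaves one factor 1 / n. *)
Lemma chebyshev_partial_sum (d : measure_display) (T : measurableType d)
    (R : realType) (P : probability T R) (X : nat -> {RV P >-> R})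
    (mu v eta : R) (n : nat) :
  (forall i, (X i : T -> R) \in Lfun P 2%:E) ->
  (forall i j, i != j -> covariance P (X i) (X j) = 0%E) ->
  (forall i, 'E_P[X i] = mu%:E)%E -> (forall i, 'V_P[X i] = v%:E)%E ->
  (0 < n)%N -> 0 < eta ->
  (P [set w | (n%:R * eta <= `|partial_sum X n w - n%:R * mu|)%R]
   <= (v / eta ^+ 2 / n%:R)%:E)%E.
Proof.
move=> X2 cov0 EX VX n0 eta0.
have n0' : (0 : R) < n%:R by rewrite ltr0n.
pose S : {RV P >-> R} := mfun_Sub (mem_set (measurable_partial_sum X n)).
have := chebyshev S (mulr_gt0 n0' eta0).
rewrite (_ : (S : T -> R) = partial_sum X n)//.
rewrite (expectation_partial_sum _ X2 EX) (variance_partial_sum _ X2 cov0 VX) /=.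
move=> /le_trans; apply; rewrite -EFinM lee_fin.
by rewrite le_eqVlt; apply/orP; left; apply/eqP; field; rewrite !gt_eqF.
Qed.

(** Nonnegativity puts both the product rule for expectations and the transfer
    to the common law within reach of Tonelli's theorem.  The constant v is the
    variance of one term. *)
Lemma ge0_chebyshev_partial_sum (d : measure_display) (T : measurableType d)
    (R : realType) (P : probability T R) (Y : nat -> {RV P >-> R}) :
  pairwise_independent Y -> identically_distributed Y ->
  (forall i w, 0 <= Y i w) -> (Y 0%N : T -> R) \in Lfun P 2%:E ->
  exists v : R, 0 <= v /\ forall eta n, 0 < eta -> (0 < n)%N ->
    (P [set w | (n%:R * eta <= `|partial_sum Y n w - n%:R * fine 'E_P[Y 0%N]|)%R]
     <= (v / eta ^+ 2 / n%:R)%:E)%E.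
Proof.
move=> indep ident Y0 Y2.
have L21 := Lfun_subset12 (fin_num_measure P _ measurableT).
have mn : measurable_fun setT (fun x : R => `|x|%:E) by exact/measurable_EFinP.
have msq : measurable_fun setT (fun x : R => (x ^+ 2)%:E).
  by apply/measurable_EFinP; exact: measurable_funX.
have L2 i : (Y i : T -> R) \in Lfun P 2%:E.
  apply: Lfun2_sqr.
  rewrite (@ge0_integral_ident _ _ _ _ Y (fun x => (x ^+ 2)%:E) i 0%N)//; last first.
    by move=> x; rewrite lee_fin sqr_ge0.
  have /integrableP[_] := Lfun2_integrable_sqr Y2.
  by under eq_integral => w _ do rewrite /= ger0_norm ?sqr_ge0//.
have EY i : ('E_P[Y i] = 'E_P[Y 0%N])%E.
  rewrite unlock.
  under eq_integral => w _ do rewrite -(ger0_norm (Y0 i w)).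
  under [RHS]eq_integral => w _ do rewrite -(ger0_norm (Y0 0%N w)).
  exact: (@ge0_integral_ident _ _ _ _ Y (fun x => `|x|%:E) i 0%N).
have VY i : ('V_P[Y i] = 'V_P[Y 0%N])%E.
  rewrite (varianceE (L2 i)) (varianceE Y2) (EY i).
  congr (_ - _)%E; rewrite unlock.
  apply: (@ge0_integral_ident _ _ _ _ Y (fun x => (x ^+ 2)%:E) i 0%N) => // x.
  by rewrite lee_fin sqr_ge0.
have cov0 i j : i != j -> covariance P (Y i) (Y j) = 0%E.
  move=> ij.
  rewrite (covarianceE (L21 _ (L2 i)) (L21 _ (L2 j)) (Lfun2_mul_Lfun1 (L2 i) (L2 j))).
  rewrite (expectation_indepM (Y0 i) (Y0 j) (indep i j ij)).
  by rewrite subee// fin_numM// expectation_fin_num// L21.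
exists (fine ('V_P[Y 0%N])%E); split; first by rewrite fine_ge0 ?variance_ge0.
move=> eta n eta0 n0; apply: chebyshev_partial_sum => // i.
- by rewrite fineK ?EY// expectation_fin_num// L21.
- by rewrite fineK ?VY// variance_fin_num.
Qed.

(** * A slowly but geometrically growing grid *)

(** Nearly geometric with ratio 1 + 1 / L, but with integer values and
    starting exactly at n.  It is strictly increasing only if L <= n:
    otherwise n %/ L = 0 and it stays at n. *)
Definition grid (L n k : nat) : nat := iter k (fun g => g + g %/ L)%N n.

Lemma gridS (L n k : nat) : grid L n k.+1 = (grid L n k + grid L n k %/ L)%N.
Proof. by []. Qed.

Lemma leq_grid (L n k : nat) : (n <= grid L n k)%N.
Proof. by elim: k => // k IHk; rewrite gridS (leq_trans IHk)// leq_addr. Qed.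

Lemma gridS_le (L n k : nat) (R : realType) : (0 < L)%N ->
  (grid L n k.+1)%:R * L%:R <= (grid L n k)%:R * (L%:R + 1) :> R.
Proof.
move=> L0; rewrite natr1 -!natrM ler_nat gridS mulnDl mulnS addnC.
by rewrite leq_add2r leq_trunc_div.
Qed.

(** Rounding loses at most half of the increment: once L <= g, the quotient
    g %/ L is at least 1, hence at least g / (2 L). *)
Lemma grid_growth (L n k : nat) (R : realType) : (0 < L)%N -> (L <= n)%N ->
  (grid L n k)%:R * (1 + (2 * L%:R)^-1) <= (grid L n k.+1)%:R :> R.
Proof.
move=> L0 Ln; have L0' : (0 : R) < L%:R by rewrite ltr0n.
have q : (grid L n k <= 2 * L * (grid L n k %/ L))%N.
  have := leq_trans Ln (leq_grid L n k).
  move: (grid L n k) => g Lg.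
  have q1 : (0 < g %/ L)%N by rewrite divn_gt0.
  have := ltn_ceil g L0.
  by move: q1; move: (g %/ L)%N => q; nia.
rewrite gridS natrD mulrDr mulr1 lerD2l ler_pdivrMr ?mulr_gt0//.
by rewrite -natrM -natrM ler_nat mulnC.
Qed.

Lemma inv_grid_le (L n k : nat) (R : realType) : (0 < L)%N -> (L <= n)%N ->
  ((grid L n k)%:R^-1 <= n%:R^-1 * ((1 + (2 * L%:R)^-1)^-1) ^+ k :> R)%R.
Proof.
move=> L0 Ln; have L0' : (0 : R) < L%:R by rewrite ltr0n.
have n0 : (0 < n)%N by exact: leq_trans Ln.
have c0 : (0 : R) < 1 + (2 * L%:R)^-1 by rewrite addr_gt0// invr_gt0 mulr_gt0.
have g0 j : (0 : R) < (grid L n j)%:R.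
  by rewrite ltr0n (leq_trans n0)// leq_grid.
rewrite exprVn -invfM lef_pV2 ?posrE//; last first.
  by rewrite mulr_gt0 ?exprn_gt0 ?ltr0n.
elim: k => [|k IHk]; first by rewrite expr0 mulr1.
rewrite exprSr mulrA (le_trans _ (grid_growth k R L0 Ln))//.
by rewrite ler_pM2r.
Qed.

Lemma grid_bracket (L n m : nat) : (0 < L)%N -> (L <= n)%N -> (n <= m)%N ->
  exists k, (grid L n k <= m < grid L n k.+1)%N.
Proof.
move=> L0 Ln nm.
have gk k : (k <= grid L n k)%N.
  elim: k => // k IHk; rewrite gridS.
  have : (0 < grid L n k %/ L)%N.
    by rewrite divn_gt0// (leq_trans Ln)// leq_grid.
  lia.
have ex : exists k, (m < grid L n k)%N by exists m.+1; exact: gk.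
case: (ex_minnP ex) => -[|k]; first by rewrite /grid/= ltnNge nm.
move=> mk kmin; exists k; rewrite mk andbT leqNgt; apply/negP => /kmin.
by rewrite ltnn.
Qed.

(** Between g and g' the sum is trapped by its values at the two ends.  Moving
    from m to an end changes the centring m * mu by at most m * mu / L; the
    error allowed at g' is at most g' * eta <= 2 * m * eta, which is where the
    factor 2 comes from. *)
Lemma monotone_bracket (R : realType) (S : nat -> R) (g g' m L : nat)
    (mu eta : R) :
  {homo S : i j / (i <= j)%N >-> i <= j} -> 0 <= mu -> 0 < eta -> (0 < L)%N ->
  (g <= m < g')%N -> g'%:R * L%:R <= g%:R * (L%:R + 1) :> R ->
  `|S g - g%:R * mu| <= g%:R * eta -> `|S g' - g'%:R * mu| <= g'%:R * eta ->
  `|S m - m%:R * mu| <= m%:R * (mu / L%:R + 2 * eta).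
Proof.
move=> homoS mu0 eta0 L0 /andP[gm mg'] gg'; rewrite !ler_norml.
move=> /andP[lo _] /andP[_ hi].
have Sg : S g <= S m by exact: homoS.
have Sg' : S m <= S g' by apply: homoS; exact: ltnW.
have L1 : (1 : R) <= L%:R by rewrite ler1n.
have gm' : g%:R <= m%:R :> R by rewrite ler_nat.
have mg : m%:R <= g'%:R :> R by rewrite ler_nat ltnW.
have g0 : (0 : R) <= g%:R by [].
have lL : g'%:R <= g%:R * (1 + L%:R^-1) :> R.
  rewrite -(ler_pM2r (lt_le_trans ltr01 L1)) (le_trans gg')//.
  by rewrite -mulrA mulrDl mul1r mulVf// gt_eqF// (lt_le_trans ltr01).
have i0 : (0 : R) <= L%:R^-1 by rewrite invr_ge0.
have i1 : L%:R^-1 <= 1 :> R by rewrite invf_le1 ?(lt_le_trans ltr01).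
move: lo hi Sg Sg' gm' mg g0 lL i0 i1 {gg'}.
(* With the quantities abstracted, only linear and quadratic facts about reals
   remain: a, b, c stand for g, g', m and l for 1 / L. *)
move: (g%:R) (g'%:R) (m%:R) (L%:R^-1) (S g) (S g') (S m) => a b c l s s' t.
move=> lo hi sa sb ac cb a0 bl l0 l1.
have ba : b - a <= c * l by nra.
have b2 : b <= 2 * c by nra.
have mul_mu x y : x <= y -> x * mu <= y * mu by move=> ?; rewrite ler_wpM2r.
have mul_eta x y : x <= y -> x * eta <= y * eta.
  by move=> ?; rewrite ler_wpM2r// ltW.
have := mul_mu _ _ ba; have := mul_eta _ _ b2; have := mul_eta _ _ ac.
have := mul_mu _ _ ac; have := mul_mu _ _ cb.
have := mul_eta _ _ (le_trans a0 ac).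
rewrite (_ : c * (mu * l + 2 * eta) = c * l * mu + 2 * c * eta); last by ring.
move=> *; apply/andP; split; lra.
Qed.

(** * The tail probability is of order 1 / n *)

Lemma nneseries_le (R : realType) (u : nat -> \bar R) (m : nat) (M : \bar R) :
  (forall k, 0 <= u k)%E -> (forall N, \sum_(m <= k < N) u k <= M)%E ->
  (\sum_(m <= k <oo) u k <= M)%E.
Proof.
move=> u0 uM; apply: lime_le; first exact: is_cvg_nneseries.
exact: nearW.
Qed.

Lemma nneseries_geometric_le (R : realType) (a q : R) :
  0 <= a -> 0 < q < 1 -> (\sum_(0 <= k <oo) (a * q ^+ k)%:E <= (a / (1 - q))%:E)%E.
Proof.
move=> a0 /andP[q0 q1]; apply: nneseries_le.
  by move=> k; rewrite lee_fin mulr_ge0// exprn_ge0// ltW.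
move=> N; rewrite sumEFin lee_fin.
by apply: (geometric_le_lim N a0 q0); rewrite ger0_norm// ltW.
Qed.

(** A supremum exceeds eps exactly when some term does; this turns the event
    into a countable union, which is measurable. *)
Lemma PstarE (d : measure_display) (T : measurableType d) (R : realType)
    (P : probability T R) (X : nat -> {RV P >-> R}) (n : nat) (eps : R) :
  Pstar X n eps = P (\bigcup_(m in [set m | (n <= m)%N])
                       [set w | eps < `|partial_sum X m w / m%:R|]).
Proof.
congr (P _); apply/seteqP; split=> w /=.
  by move=> /ereal_sup_gtP[_ [m nm <-]]; rewrite lte_fin => ?; exists m.
move=> [m nm ?]; apply/ereal_sup_gtP.
by exists (`|partial_sum X m w / m%:R|)%:E; [exists m|rewrite lte_fin].
Qed.

Lemma measurable_exceed (d : measure_display) (T : measurableType d)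
    (R : realType) (P : probability T R) (X : nat -> {RV P >-> R}) (n : nat)
    (eps : R) :
  measurable (\bigcup_(m in [set m | (n <= m)%N])
                [set w | eps < `|partial_sum X m w / m%:R|]).
Proof.
apply: bigcup_measurable => m _.
have mS : measurable_fun setT (fun w => `|partial_sum X m w / m%:R|).
  apply: measurableT_comp => //.
  by apply: measurable_funM => //; exact: measurable_partial_sum.
have := mS measurableT _ (measurable_itv `]eps, +oo[).
rewrite setTI (_ : _ @^-1` _ = [set w | eps < `|partial_sum X m w / m%:R|])//.
by apply/seteqP; split=> w /=; rewrite in_itv/= andbT.
Qed.

Lemma Pstar_le1 (d : measure_display) (T : measurableType d) (R : realType)
    (P : probability T R) (X : nat -> {RV P >-> R}) (n : nat) (eps : R) :
  (Pstar X n eps <= 1)%E.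
Proof. by rewrite PstarE probability_le1//; exact: measurable_exceed. Qed.

Lemma measurable_deviation (d : measure_display) (T : measurableType d)
    (R : realType) (P : probability T R) (X : nat -> {RV P >-> R}) (n : nat)
    (a b : R) :
  measurable [set w | a <= `|partial_sum X n w - b|].
Proof.
have mS : measurable_fun setT (fun w => `|partial_sum X n w - b|).
  apply: measurableT_comp => //.
  by apply: measurable_funB => //; exact: measurable_partial_sum.
have := mS measurableT _ (measurable_itv `[a, +oo[).
rewrite setTI (_ : _ @^-1` _ = [set w | a <= `|partial_sum X n w - b|])//.
by apply/seteqP; split=> w /=; rewrite in_itv/= andbT.
Qed.

Lemma nondecreasing_partial_sum (d : measure_display) (T : measurableType d)
    (R : realType) (P : probability T R) (Y : nat -> {RV P >-> R}) (w : T) :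
  (forall i w, 0 <= Y i w) ->
  {homo (fun n => partial_sum Y n w) : i j / (i <= j)%N >-> i <= j}.
Proof.
move=> Y0; apply: homo_leq => [//|? ? ? |n]; first exact: le_trans.
by rewrite partial_sumS /= lerDl.
Qed.

(** With eta = eps / 8 and mu / L <= eps / 4, the bound mu / L + 2 eta of
    [monotone_bracket] is eps / 2 for each of A and B, hence eps for their
    difference X. *)
Lemma exceed_subset_deviation (d : measure_display) (T : measurableType d)
    (R : realType) (P : probability T R) (X A B : nat -> {RV P >-> R})
    (mu eps : R) (L n : nat) :
  (forall i w, 0 <= A i w) -> (forall i w, 0 <= B i w) ->
  (forall i w, X i w = A i w - B i w) ->
  0 <= mu -> 0 < eps -> (0 < L)%N -> (L <= n)%N -> mu / L%:R <= eps / 4 ->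
  \bigcup_(m in [set m | (n <= m)%N])
     [set w | eps < `|partial_sum X m w / m%:R|] `<=`
  \bigcup_k ([set w | (grid L n k)%:R * (eps / 8)
                <= `|partial_sum A (grid L n k) w - (grid L n k)%:R * mu|] `|`
             [set w | (grid L n k)%:R * (eps / 8)
                <= `|partial_sum B (grid L n k) w - (grid L n k)%:R * mu|]).
Proof.
move=> A0 B0 XAB mu0 eps0 L0 Ln muL w [m /= nm]; apply: contraPP => nbad.
have good (Y : nat -> {RV P >-> R}) : Y = A \/ Y = B -> forall k,
    `|partial_sum Y (grid L n k) w - (grid L n k)%:R * mu|
      <= (grid L n k)%:R * (eps / 8).
  move=> YAB k; rewrite leNgt; apply/negP => h; apply: nbad.
  by exists k => //=; case: YAB h => -> /ltW; [left|right].
have m0 : (0 : R) < m%:R by rewrite ltr0n (leq_trans L0)// (leq_trans Ln).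
have [k kb] := grid_bracket L0 Ln nm.
have close (Y : nat -> {RV P >-> R}) : Y = A \/ Y = B ->
    `|partial_sum Y m w - m%:R * mu| <= m%:R * (eps / 2).
  move=> YAB; have Y0 i w' : 0 <= Y i w' by case: YAB => ->.
  have e8 : 0 < eps / 8 by rewrite divr_gt0.
  have := monotone_bracket (nondecreasing_partial_sum w Y0) mu0 e8 L0 kb
    (gridS_le n k R L0) (good Y YAB k) (good Y YAB k.+1).
  move=> /le_trans; apply; rewrite ler_pM2l//; lra.
have SX : partial_sum X m w = partial_sum A m w - partial_sum B m w.
  by rewrite /partial_sum -sumrB; apply: eq_bigr => i _; exact: XAB.
apply/negP; rewrite -leNgt normrM normfV (gtr0_norm m0) ler_pdivrMr// SX.
have := close A (or_introl erefl); have := close B (or_intror erefl).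
rewrite !ler_norml => /andP[? ?] /andP[? ?]; apply/andP; split; lra.
Qed.

(** For n < L the grid does not move, but there L / n already exceeds 1.  For
    L <= n the deviation bounds along the grid sum to K / n / (1 - q), where q
    is the inverse of the growth factor of the grid. *)
Lemma Pstar_le_inv (d : measure_display) (T : measurableType d) (R : realType)
    (P : probability T R) (X A B : nat -> {RV P >-> R}) (mu v eps : R) :
  (forall i w, 0 <= A i w) -> (forall i w, 0 <= B i w) ->
  (forall i w, X i w = A i w - B i w) -> 0 <= mu -> 0 <= v -> 0 < eps ->
  (forall (eta : R) n, 0 < eta -> (0 < n)%N ->
    (P [set w | (n%:R * eta <= `|partial_sum A n w - n%:R * mu|)%R]
     <= (v / eta ^+ 2 / n%:R)%:E)%E) ->
  (forall (eta : R) n, 0 < eta -> (0 < n)%N ->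
    (P [set w | (n%:R * eta <= `|partial_sum B n w - n%:R * mu|)%R]
     <= (v / eta ^+ 2 / n%:R)%:E)%E) ->
  exists C : R, forall n, (0 < n)%N -> (Pstar X n eps <= (C / n%:R)%:E)%E.
Proof.
move=> A0 B0 XAB mu0 v0 eps0 devA devB.
pose L := (Num.truncn (4 * mu / eps)).+1.
have L0 : (0 < L)%N by [].
have LR : (0 : R) < L%:R by rewrite ltr0n.
have muL : mu / L%:R <= eps / 4.
  have : 4 * mu / eps < L%:R by exact: truncnS_gt.
  rewrite ltr_pdivrMr// => h; rewrite ler_pdivrMr//; lra.
have e8 : 0 < eps / 8 by rewrite divr_gt0.
(* The factor 2 counts the deviations of A and of B. *)
pose K := 2 * (v / (eps / 8) ^+ 2).
have K0 : 0 <= K by rewrite mulr_ge0// divr_ge0// sqr_ge0.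
pose q : R := (1 + (2 * L%:R)^-1)^-1.
have i0 : (0 : R) < (2 * L%:R)^-1 by rewrite invr_gt0 mulr_gt0.
have q01 : 0 < q < 1.
  by rewrite invr_gt0 invf_lt1 ?ltrDl ?addr_gt0// i0.
have q1' : 0 < 1 - q by case/andP: q01 => _ ?; rewrite subr_gt0.
exists (L%:R + K / (1 - q)) => n n0.
have nR : (0 : R) < n%:R by rewrite ltr0n.
have [Ln|nL] := leqP L n; last first.
  rewrite (le_trans (Pstar_le1 X n eps))// lee_fin ler_pdivlMr// mul1r.
  by rewrite (@le_trans _ _ L%:R) ?ler_nat ?(ltnW nL)// lerDl divr_ge0// ltW.
have g0 k : (0 < grid L n k)%N by rewrite (leq_trans n0)// leq_grid.
rewrite PstarE.
apply: (le_trans (measure_sigma_subadditive P _ _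
  (exceed_subset_deviation A0 B0 XAB mu0 eps0 L0 Ln muL))).
- by move=> k; apply: measurableU; exact: measurable_deviation.
- exact: measurable_exceed.
apply: (@le_trans _ _ (\sum_(0 <= k <oo) (K / n%:R * q ^+ k)%:E)%E).
  apply: lee_nneseries => // k _.
  apply: (le_trans (measureU2 _ _ _)); try exact: measurable_deviation.
  apply: (le_trans (leeD (devA _ _ e8 (g0 k)) (devB _ _ e8 (g0 k)))).
  rewrite -EFinD lee_fin -mulrDl -mulr2n -(mulr_natl _ 2) -/K -mulrA.
  by rewrite ler_wpM2l// inv_grid_le.
apply: (le_trans (nneseries_geometric_le _ q01)); first by rewrite divr_ge0// ltW.
rewrite lee_fin mulrAC ler_pM2r ?invr_gt0//.
by rewrite lerDr ltW.
Qed.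

(** * Summation against powers *)

(** A discrete form of the mean value theorem for x^r.  Dividing by (n+1)^r,
    it reads 1 - r / (n+1) <= exp (r * ln (n / (n+1))), which follows from
    ln (1 + x) <= x and 1 + x <= exp x. *)
Lemma powR_div_le_telescope (R : realType) (r : R) (n : nat) :
  r < 0 -> (0 < n)%N ->
  n.+1%:R `^ r / n.+1%:R <= (n%:R `^ r - n.+1%:R `^ r) / (- r) :> R.
Proof.
move=> r0 n0; have n0' : (0 : R) < n%:R by rewrite ltr0n.
have m0 : (0 : R) < n.+1%:R by [].
have r0' : 0 < - r by rewrite oppr_gt0.
have t0 : (0 : R) < n%:R / n.+1%:R by rewrite divr_gt0.
have split_pow : n%:R `^ r = n.+1%:R `^ r * (n%:R / n.+1%:R) `^ r :> R.
  by rewrite -powRM ?(ltW t0)// mulrC divfK// gt_eqF.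
have lnt : ln (n%:R / n.+1%:R) <= - n.+1%:R^-1 :> R.
  have -> : n%:R / n.+1%:R = 1 + (- n.+1%:R^-1) :> R.
    by rewrite -natr1; field; rewrite natr1 gt_eqF.
  by apply: le_ln1Dx; rewrite ltrN2 invf_lt1// ltr1n.
have t1 : 1 + (- r) / n.+1%:R <= (n%:R / n.+1%:R) `^ r.
  rewrite /powR (gt_eqF t0) (le_trans _ (expR_ge1Dx _))// lerD2l.
  by rewrite mulNr -mulrN ler_wnM2l// ltW.
rewrite ler_pdivlMr// split_pow -mulrA (mulrC _ (- r)).
rewrite -[X in _ <= _ - X]mulr1 -mulrBr ler_wpM2l ?powR_ge0//.
by rewrite lerBrDl.
Qed.

Lemma sum_powR_div_le (R : realType) (r : R) (N : nat) :
  r < 0 -> \sum_(1 <= n < N) n%:R `^ r / n%:R <= 1 + (- r)^-1.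
Proof.
move=> r0; have r0' : 0 < (- r)^-1 by rewrite invr_gt0 oppr_gt0.
suff H M : \sum_(1 <= n < M.+2) n%:R `^ r / n%:R
    <= 1 + (1 - M.+1%:R `^ r) / (- r).
  have [N1|] := leqP N 1; first by rewrite big_geq// addr_ge0// ltW.
  case: N => [|[|N]]// _.
  apply: (le_trans (H N)).
  by rewrite lerD2l ler_piMl ?(ltW r0')// gerBl powR_ge0.
elim: M => [|M IHM].
  by rewrite big_nat1 powR1/= subrr mul0r addr0 divr1.
rewrite big_nat_recr//=.
apply: (le_trans (lerD IHM (powR_div_le_telescope r0 (ltn0Sn M)))).
by rewrite -addrA -mulrDl addrA subrK.
Qed.

(** * Positive and negative parts *)

Lemma pairwise_independent_comp (d : measure_display) (T : measurableType d)
    (R : realType) (P : probability T R) (X Y : nat -> {RV P >-> R})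
    (f : R -> R) :
  measurable_fun setT f -> (forall i, (Y i : T -> R) = f \o X i) ->
  pairwise_independent X -> pairwise_independent Y.
Proof.
move=> mf YE indep i j ij A B mA mB.
have mpre C : measurable C -> measurable (f @^-1` C).
  by move=> mC; rewrite -[X in measurable X]setTI; exact: mf.
have YpreE k C : Y k @^-1` C = X k @^-1` (f @^-1` C) by rewrite YE.
by rewrite !YpreE; exact: (indep i j ij _ _ (mpre _ mA) (mpre _ mB)).
Qed.

Lemma identically_distributed_comp (d : measure_display) (T : measurableType d)
    (R : realType) (P : probability T R) (X Y : nat -> {RV P >-> R})
    (f : R -> R) :
  measurable_fun setT f -> (forall i, (Y i : T -> R) = f \o X i) ->
  identically_distributed X -> identically_distributed Y.
Proof.
move=> mf YE ident i j A mA.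
have YpreE k : distribution P (Y k) A = distribution P (X k) (f @^-1` A).
  by rewrite /distribution /pushforward YE.
by rewrite !YpreE; apply: ident; rewrite -[X in measurable X]setTI; exact: mf.
Qed.

(** An infinite part would make the expectation infinite, since oo - oo is -oo
    in the extended reals; so both parts have finite expectation, and their
    difference is 0. *)
Lemma expectation0_funrpos_funrneg (d : measure_display) (T : measurableType d)
    (R : realType) (P : probability T R) (X : {RV P >-> R}) :
  ('E_P[X] = 0 -> 'E_P[X^\+%R] = 'E_P[X^\-%R])%E.
Proof.
rewrite unlock integralE.
have -> : (\int[P]_w (fun x => (X x)%:E)^\+ w = \int[P]_w (X^\+%R w)%:E)%E.
  by apply: eq_integral => w _; rewrite funeposE -EFin_max.
have -> : (\int[P]_w (fun x => (X x)%:E)^\- w = \int[P]_w (X^\-%R w)%:E)%E.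
  by apply: eq_integral => w _; rewrite funenegE -EFinN -EFin_max.
have : (0 <= \int[P]_w (X^\+%R w)%:E)%E.
  by apply: integral_ge0 => w _; rewrite lee_fin funrpos_ge0.
have : (0 <= \int[P]_w (X^\-%R w)%:E)%E.
  by apply: integral_ge0 => w _; rewrite lee_fin funrneg_ge0.
move: (\int[P]_w (X^\+%R w)%:E)%E (\int[P]_w (X^\-%R w)%:E)%E.
by move=> [a| |] [b| |]//= _ _ [] /eqP; rewrite subr_eq0 => /eqP ->.
Qed.

Lemma Lfun2_le_norm (d : measure_display) (T : measurableType d)
    (R : realType) (P : probability T R) (X Y : {RV P >-> R}) :
  (forall w, `|Y w| <= `|X w|) -> (X : T -> R) \in Lfun P 2%:E ->
  (Y : T -> R) \in Lfun P 2%:E.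
Proof.
move=> YX X2; apply: Lfun2_sqr.
have /integrableP[mX] := Lfun2_integrable_sqr X2.
apply: le_lt_trans; apply: ge0_le_integral => //=.
- by move=> w _; rewrite lee_fin sqr_ge0.
- by apply/measurable_EFinP; exact: measurable_funX.
- by apply/measurable_EFinP; apply: measurableT_comp => //; exact: measurable_funX.
- by move=> w _; rewrite lee_fin normrX -(real_normK (num_real (Y w))) lerXn2r.
Qed.

(** The mean 0 makes the two parts share the centre mu; the sum of their
    variances serves as a constant common to both. *)
Lemma Pstar_le_inv_pairwise (d : measure_display) (T : measurableType d)
    (R : realType) (P : probability T R) (X : nat -> {RV P >-> R}) (eps : R) :
  pairwise_independent X -> identically_distributed X ->
  ('E_P[X 0%N] = 0)%E -> ('V_P[X 0%N] < +oo)%E -> 0 < eps ->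
  exists C : R, forall n, (0 < n)%N -> (Pstar X n eps <= (C / n%:R)%:E)%E.
Proof.
move=> indep ident mean0 varfin eps0.
have X2 : (X 0%N : T -> R) \in Lfun P 2%:E.
  apply: Lfun2_sqr; apply: le_lt_trans varfin.
  rewrite /variance covariance.unlock mean0 expectation.unlock le_eqVlt.
  apply/orP; left; apply/eqP; apply: eq_integral => w _.
  by rewrite !fctE /= subr0 expr2.
pose A i : {RV P >-> R} := (X i)^\+; pose B i : {RV P >-> R} := (X i)^\-.
have A0 i w : 0 <= A i w by exact: funrpos_ge0.
have B0 i w : 0 <= B i w by exact: funrneg_ge0.
have XAB i w : X i w = A i w - B i w by rewrite -[in LHS](funrposBneg (X i)).
have mpos : measurable_fun setT (fun x : R => Num.max x 0).
  by apply: measurable_maxr.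
have mneg : measurable_fun setT (fun x : R => Num.max (- x) 0).
  by apply: measurable_maxr => //; exact: measurable_oppr.
(* One of the two parts vanishes at each point, so each is dominated by X. *)
have norm_le (a b x : R) : 0 <= a -> 0 <= b -> x = a - b -> a * b = 0 ->
    `|a| <= `|x| /\ `|b| <= `|x|.
  move=> a0 b0 -> /eqP; rewrite mulf_eq0 => /orP[] /eqP ->;
  by rewrite ?sub0r ?subr0 ?normrN ?normr0 ?normr_ge0.
have AB0 i w : A i w * B i w = 0.
  rewrite -[A i w]/(Num.max (X i w) 0) -[B i w]/(Num.max (- X i w) 0).
  case/orP: (le_total (X i w) 0) => Xi; first by rewrite (max_r Xi) mul0r.
  by rewrite [X in _ * X]max_r ?mulr0// oppr_le0.
have EAB : ('E_P[A 0%N] = 'E_P[B 0%N])%E by exact: expectation0_funrpos_funrneg.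
have A2 : (A 0%N : T -> R) \in Lfun P 2%:E.
  apply: (Lfun2_le_norm _ X2) => w.
  by case: (norm_le _ _ _ (A0 0%N w) (B0 0%N w) (XAB 0%N w) (AB0 0%N w)).
have B2 : (B 0%N : T -> R) \in Lfun P 2%:E.
  apply: (Lfun2_le_norm _ X2) => w.
  by case: (norm_le _ _ _ (A0 0%N w) (B0 0%N w) (XAB 0%N w) (AB0 0%N w)).
have [vA [vA0 devA]] := ge0_chebyshev_partial_sum
  (pairwise_independent_comp (Y := A) mpos (fun=> erefl) indep)
  (identically_distributed_comp (Y := A) mpos (fun=> erefl) ident) A0 A2.
have [vB [vB0 devB]] := ge0_chebyshev_partial_sum
  (pairwise_independent_comp (Y := B) mneg (fun=> erefl) indep)
  (identically_distributed_comp (Y := B) mneg (fun=> erefl) ident) B0 B2.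
have wk (v v' eta : R) (n : nat) : v <= v' ->
    ((v / eta ^+ 2 / n%:R)%:E <= (v' / eta ^+ 2 / n%:R)%:E)%E.
  by move=> vv; rewrite lee_fin !ler_wpM2r// invr_ge0// sqr_ge0.
apply: (@Pstar_le_inv _ _ _ P X A B (fine 'E_P[A 0%N])%E (vA + vB) eps) => //.
- by rewrite fine_ge0// expectation_ge0.
- by rewrite addr_ge0.
- move=> eta n eta0 n0; apply: (le_trans (devA eta n eta0 n0)).
  by apply: wk; rewrite lerDl.
- move=> eta n eta0 n0; rewrite EAB; apply: (le_trans (devB eta n eta0 n0)).
  by apply: wk; rewrite lerDr.
Qed.

Theorem corollary1p7 (d : measure_display) (T : measurableType d)
    (R : realType) (P : probability T R) (X : nat -> {RV P >-> R})
    (indep : pairwise_independent X)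
    (ident : identically_distributed X)
    (mean0 : ('E_P[X 0%N] = 0)%E)
    (varfin : ('V_P[X 0%N] < +oo)%E) :
  forall eps r : R, 0 < eps -> r < 0 ->
    (\sum_(1 <= n <oo) (n%:R `^ r)%:E * Pstar X n eps < +oo)%E.
Proof.
move=> eps r eps0 r0.
have [C PC] := Pstar_le_inv_pairwise indep ident mean0 varfin eps0.
have P0 n : (0 <= Pstar X n eps)%E by exact: measure_ge0.
have C0 : 0 <= C.
  by have := le_trans (P0 1%N) (PC 1%N isT); rewrite lee_fin divr1.
apply: le_lt_trans (ltry (C * (1 + (- r)^-1))).
apply: nneseries_le => [k|N]; first by rewrite mule_ge0// lee_fin powR_ge0.
apply: (@le_trans _ _ (\sum_(1 <= n < N) (C * (n%:R `^ r / n%:R))%:E)%E).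
  rewrite big_nat [leRHS]big_nat; apply: lee_sum => n /andP[n0 _].
  rewrite mulrCA EFinM; apply: lee_wpmul2l (PC n n0).
  by rewrite lee_fin powR_ge0.
by rewrite sumEFin lee_fin -mulr_sumr ler_wpM2l// sum_powR_div_le.
Qed.
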